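(* Let $h\ge 1$ and $n>2h$ be integers, let $\{w_{-h},\dots,w_0,\dots,w_h\}$ be a symmetric filter (real weights with $w_{-d}=w_d$), let $\mathbf{S}$ be an $n\times n$ smoothing matrix associated with this filter, and let $\mathbf{H}$ be the corresponding $n\times n$ matrix in $\tau_{11}$. Then for every $\lambda\in\sigma(\mathbf{S})$ there exists $i\in\{1,2,\dots,n\}$ such that $$|\lambda-\xi_i|\leq\delta_H,$$ where $$\xi_i=\sum_{j=1}^{h+1}\left(2\cos\frac{(i-1)\pi}{n}\right)^{j-1}\left[w_{j-1}+\sum_{q=0}^{\left\lfloor\frac{h-j-1}{2}\right\rfloor}\frac{(-1)^{q+1}(j)_q}{(q+1)!}(j+2q+1)\,w_{j+2q+1}\right]$$ and $\delta_H=\|\mathbf{S}-\mathbf{H}\|_2$.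
   Context: $\sigma(\mathbf{A})$ denotes the set of (complex) eigenvalues of a square matrix $\mathbf{A}$, and $\|\mathbf{A}\|_2=\sqrt{\rho(\mathbf{A}'\mathbf{A})}$, where $\mathbf{A}'$ is the transpose and $\rho$ is the spectral radius. $(j)_q=j(j+1)\cdots(j+q-1)$ is the Pochhammer symbol, with $(j)_0=1$; $\lfloor x\rfloor$ is the largest integer not exceeding $x$; a sum over $q$ whose upper limit is negative is empty (equal to $0$). Smoothing matrix: an $n\times n$ smoothing matrix associated with the symmetric filter $\{w_{-h},\dots,w_h\}$ is a real matrix $\mathbf{S}=(s_{tj})$ such that: (i) for $t=h+1,\dots,n-h$, row $t$ carries the symmetric filter centred at $t$, i.e. $s_{tj}=w_{j-t}$ if $|j-t|\le h$ and $s_{tj}=0$ otherwise; (ii) the first $h$ rows have nonzero entries only in the first $2h$ columns, and the last $h$ rows have nonzero entries only in the last $2h$ columns (these rows contain the weights of arbitrary asymmetric filters used at the boundaries); (iii) $\mathbf{S}$ is centrosymmetric: $s_{tj}=s_{n+1-t,\,n+1-j}$ for all $t,j$. The algebra $\tau_{11}$: let $\mathbf{T}_{11}$ be the $n\times n$ symmetric tridiagonal matrix with ones on the first sub- and superdiagonals, entries $(1,1)$ and $(n,n)$ equal to $1$, and all other entries $0$. An $n\times n$ matrix $\mathbf{H}$ belongs to $\tau_{11}$ if and only if $\mathbf{T}_{11}\mathbf{H}=\mathbf{H}\mathbf{T}_{11}$. A matrix in $\tau_{11}$ is determined by its first row. The matrix in $\tau_{11}$ corresponding to the symmetric filter is the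 matrix $\mathbf{H}\in\tau_{11}$ whose first row is $$[\,w_0+w_1,\;w_1+w_2,\;w_2+w_3,\;\dots,\;w_{h-1}+w_h,\;w_h,\;0,\dots,0\,].$$ *)

(* Defs.v *)
From HB Require Import structures.
From mathcomp Require Import all_boot all_order all_algebra.
From mathcomp Require Import complex.
From mathcomp Require Import classical_sets reals trigo.

Set Implicit Arguments.
Unset Strict Implicit.
Unset Printing Implicit Defensive.
Import Order.TTheory GRing.Theory Num.Theory.
Local Open Scope classical_set_scope.
Local Open Scope ring_scope.
Local Open Scope complex_scope.

(* Rows and columns are indexed by 'I_n, that is from 0 to n - 1. *)

Definition spectrum (R : realType) (n : nat) (A : 'M[R]_n) : set R[i] :=
  [set l | eigenvalue (map_mx (real_complex R) A) l].

(* On R[i] the norm is itself R[i]-valued (with zero imaginary part), whence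
   the projection; for n > 0 the supremum is over a finite nonempty set. *)
Definition spectral_radius (R : realType) (n : nat) (A : 'M[R]_n) : R :=
  sup [set complex.Re `|l| | l in spectrum A].

Definition norm2 (R : realType) (n : nat) (A : 'M[R]_n) : R :=
  Num.sqrt (spectral_radius (A^T *m A)).

(* A filter is a family of weights indexed by int, of which only w_{-h}, ...,
   w_h are constrained or used. *)
Definition symmetric_filter (R : realType) (h : nat) (w : int -> R) : Prop :=
  forall d : int, `|d| <= h%:Z -> w (- d) = w d.

Record smoothing_matrix (R : realType) (h n : nat) (w : int -> R)
    (S : 'M[R]_n) : Prop := SmoothingMatrix {
  smoothing_interior : forall t j : 'I_n, (h <= t)%N -> (t < n - h)%N ->
    S t j = if `|j%:Z - t%:Z| <= h%:Z then w (j%:Z - t%:Z) else 0;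
  smoothing_top : forall t j : 'I_n,
    (t < h)%N -> (2 * h <= j)%N -> S t j = 0;
  smoothing_bottom : forall t j : 'I_n,
    (n - h <= t)%N -> (j < n - 2 * h)%N -> S t j = 0;
  smoothing_centrosymmetric : forall t j : 'I_n,
    S t j = S (rev_ord t) (rev_ord j)
}.

Definition T11 (R : realType) (n : nat) : 'M[R]_n :=
  \matrix_(i, j)
    if [|| i.+1 == j :> nat, j.+1 == i :> nat
         | (i == j) && ((i == 0 :> nat) || (i == n.-1 :> nat))]
    then 1 else 0.

Definition tau11 (R : realType) (n : nat) : set 'M[R]_n :=
  [set H | T11 R n *m H = H *m T11 R n].

Definition tau11_of_filter (R : realType) (h n : nat) (w : int -> R)
    (H : 'M[R]_n) : Prop :=
  tau11 H /\
  forall i j : 'I_n, i = 0%N :> nat ->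
    H i j = if (j < h)%N then w j%:Z + w j.+1%:Z
            else if j == h :> nat then w h%:Z else 0.

Definition pochhammer (j q : nat) : nat := (\prod_(0 <= k < q) (j + k))%N.

(* The inner sum ranges over 0 <= q <= floor ((h - j - 1) / 2), and
   floor ((h - j - 1) / 2) + 1 = floor ((h + 1 - j) / 2) is nonnegative for
   j <= h + 1. *)
Definition xi (R : realType) (h n : nat) (w : int -> R) (i : nat) : R :=
  \sum_(1 <= j < h.+2)
    (2 * cos (i.-1%:R * pi / n%:R)) ^+ j.-1 *
    (w j.-1%:Z +
     \sum_(0 <= q < (h.+1 - j)./2)
       (-1) ^+ q.+1 * (pochhammer j q)%:R / (q.+1)`!%:R
       * (j + 2 * q + 1)%:R * w (j + 2 * q + 1)%:Z).

(* Main.v *)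
(* T11 has the n distinct eigenvalues 2 cos (k pi / n), with eigenvectors
   cos ((j + 1/2) k pi / n), so these vectors form an orthogonal basis and every
   H commuting with T11 is diagonal in it.  Since the j = 0 entries of the
   eigenvectors do not vanish, the eigenvalues of H are read off its first row:
   they are w_0 + 2 sum_d w_d cos (d k pi / n).  Expanding 2 cos (d t) as a
   polynomial in 2 cos t (Lucas' form of the Chebyshev polynomials) turns this
   into xi.  As H is orthogonally diagonalizable, the Bauer-Fike argument gives
   the bound with constant 1. *)
Require Import Defs.
From mathcomp Require Import all_boot all_order all_algebra.
From mathcomp Require Import complex.
From mathcomp Require Import classical_sets reals trigo.
From mathcomp Require Import zify ring lra.
Import Order.TTheory GRing.Theory Num.Theory.
Local Open Scope ring_scope.
Local Open Scope complex_scope.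

Set Implicit Arguments.
Unset Strict Implicit.

(** * Lucas coefficients and cosines of multiple angles *)

(* Up to the sign (-1)^p, this is the coefficient of x^(d - 2p) in the polynomial
   C_d with C_d (2 cos t) = 2 cos (d t); hence the value 2 at d = 0. *)
Fixpoint lucas_coef (d : nat) {struct d} : nat -> nat :=
  match d with
  | 0 => fun p => if p is 0 then 2 else 0
  | 1 => fun p => if p is 0 then 1 else 0
  | (e.+1 as d').+1 => fun p =>
      if p is q.+1 then lucas_coef d' q.+1 + lucas_coef e q else 1
  end%N.

Lemma lucas_coefSS d p :
  lucas_coef d.+2 p.+1 = (lucas_coef d.+1 p.+1 + lucas_coef d p)%N.
Proof. by []. Qed.

Lemma lucas_coefS0 d : lucas_coef d.+1 0 = 1%N.
Proof. by case: d. Qed.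

Lemma nat_ind2 (P : nat -> Prop) :
  P 0%N -> P 1%N -> (forall d, P d -> P d.+1 -> P d.+2) -> forall d, P d.
Proof.
move=> P0 P1 PS d; suff: P d /\ P d.+1 by case.
by elim: d => [|d [IH1 IH2]]; split=> //; apply: PS.
Qed.

Lemma lucas_coef_eq0 d p : (d < 2 * p)%N -> lucas_coef d p = 0%N.
Proof.
elim/nat_ind2: d p => [[|p]|[|p]|d IH1 IH2 [|p]] // lt_dp.
by rewrite lucas_coefSS IH2 ?IH1 //; lia.
Qed.

(** The closed form d/(d-p) * binom(d-p, p) for p = q + 1 and d = m + 2q + 2, cleared of
    denominators to stay in [nat]. Each term of the recurrence lowers m or q by one, hence the
    strong induction on m + 2q. *)
Lemma lucas_coef_fact m q :
  (lucas_coef (m + 2 * q + 2) q.+1 * q.+1`! * m`! =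
   (m + q)`! * (m + 2 * q + 2))%N.
Proof.
have [N leN] := ubnP (m + 2 * q); elim: N => // N IH in m q leN *.
rewrite addn2 lucas_coefSS !mulnDl.
(* At m = 0 the coefficient vanishes, and the factor m makes the truncated predecessor harmless. *)
have -> : (lucas_coef (m + 2 * q).+1 q.+1 * q.+1`! * m`!
           = m * ((m + q).-1`! * (m + 2 * q + 1)))%N.
  case: m leN => [|m] leN; first by rewrite lucas_coef_eq0 //; lia.
  have -> : ((m.+1 + 2 * q).+1 = m + 2 * q + 2)%N by lia.
  rewrite [m.+1`!]factS mulnCA IH; last by lia.
  by rewrite addSn /=; congr (_ * (_ * _))%N; lia.
case: q leN => [|q] leN.
  case: m leN => [|m] leN //.
  by rewrite muln0 !addn0 lucas_coefS0 !factS fact0 /=; ring.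
rewrite [q.+2`!]factS.
have -> : (m + 2 * q.+1 = m + 2 * q + 2)%N by lia.
have -> : (lucas_coef (m + 2 * q + 2) q.+1 * (q.+2 * q.+1`!) * m`! =
           q.+2 * ((m + q)`! * (m + 2 * q + 2)))%N.
  by rewrite -IH; [ring | lia].
by rewrite addnS factS /=; ring.
Qed.

Lemma pochhammer_fact m q : (pochhammer m.+1 q * m`! = (m + q)`!)%N.
Proof.
elim: q => [|q IH]; first by rewrite /pochhammer big_geq ?addn0 ?mul1n.
rewrite /pochhammer big_nat_recr //= -/(pochhammer _ _) mulnAC IH addnS factS.
by rewrite mulnC addSn.
Qed.

(** Since (m+1)_q = (m+q)!/m!, the closed form identifies the coefficients in [xi] for j = m + 1, up
    to sign, with Lucas coefficients of degree j + 2q + 1. *)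
Lemma lucas_coef_pochhammer (F : numFieldType) m q :
  (pochhammer m.+1 q)%:R / (q.+1)`!%:R * (m.+1 + 2 * q + 1)%:R =
  (lucas_coef (m + 2 * q + 2) q.+1)%:R :> F.
Proof.
have fact_neq0 k : k`!%:R != 0 :> F by rewrite pnatr_eq0 -lt0n fact_gt0.
have -> : (m.+1 + 2 * q + 1 = m + 2 * q + 2)%N by lia.
have : (lucas_coef (m + 2 * q + 2) q.+1)%:R * q.+1`!%:R * m`!%:R =
       (pochhammer m.+1 q)%:R * m`!%:R * (m + 2 * q + 2)%:R :> F.
  by rewrite -!natrM lucas_coef_fact pochhammer_fact.
move: (fact_neq0 m) (fact_neq0 q.+1); move: m`!%:R q.+1`!%:R => f g f0 g0 E.
by apply: (mulIf g0); apply: (mulIf f0); rewrite E; field.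
Qed.

(** Both sides satisfy u_(d+2) = 2 cos t * u_(d+1) - u_d. *)
Lemma lucas_cos (R : realType) (t : R) d :
  \sum_(0 <= p < d.+1)
    (-1) ^+ p * (lucas_coef d p)%:R * (2 * cos t) ^+ (d - 2 * p)
  = 2 * cos (d%:R * t).
Proof.
set x := 2 * cos t.
pose P e N :=
  \sum_(0 <= p < N) (-1) ^+ p * (lucas_coef e p)%:R * x ^+ (e - 2 * p).
(* Padding with vanishing terms lets the three sums of the recurrence be matched index by index. *)
have PE e : P e e.+2 = P e e.+1.
  rewrite /P big_nat_recr //= lucas_coef_eq0; last by lia.
  by rewrite mulr0 mul0r addr0.
rewrite -/(P d d.+1); elim/nat_ind2: d => [||d IH1 IH2].
- by rewrite /P big_nat1 /= mul0r cos0; ring.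
- rewrite /P !big_nat_recr // big_geq //=.
  by rewrite mulr0 mul0r !mul1r muln0 subn0 add0r addr0.
have -> : P d.+2 d.+3 = x * P d.+1 d.+3 - P d d.+2.
  rewrite /P big_nat_recl // [in X in _ = x * X - _]big_nat_recl //.
  rewrite !lucas_coefS0 mulrDr !expr0 !mulr_sumr -addrA -sumrB.
  congr (_ + _); first by rewrite mul1r exprS muln0 !subn0 !mul1r.
  apply: eq_big_nat => p _; rewrite lucas_coefSS natrD.
  have -> : (d.+2 - 2 * p.+1 = d - 2 * p)%N by lia.
  (* Where the exponent [d.+1 - 2 * p.+1] is truncated, the powers disagree but their coefficient is
     zero. *)
  have [le_d|lt_d] := leqP (2 * p.+1) d.+1.
    have -> : (d - 2 * p = (d.+1 - 2 * p.+1).+1)%N by lia.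
    by rewrite !exprS; ring.
  by rewrite (lucas_coef_eq0 lt_d) exprS; ring.
rewrite !PE IH1 IH2 /x.
have -> : d.+2%:R * t = d.+1%:R * t + t by rewrite -natr1; ring.
have -> : d%:R * t = d.+1%:R * t - t by rewrite -natr1; ring.
by rewrite cosB cosD; ring.
Qed.

(** * Rewriting [xi] as a cosine sum *)

(** Substituting d = m + 2(q+1), the index of the weight in [xi], turns the bound on q into 2(q+1)
    <= d <= h. *)
Lemma sum_antidiagonal (V : nmodType) h (f : nat -> nat -> V) :
  \sum_(0 <= m < h.+1) \sum_(0 <= q < (h - m)./2) f m q =
  \sum_(0 <= d < h.+1) \sum_(0 <= q < d./2) f (d - 2 * q.+1)%N q.
Proof.
have widen g k : (k <= h)%N -> \sum_(0 <= q < k./2) g q =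
    \sum_(0 <= q < h | (2 * q.+1 <= k)%N) g q :> V.
  move=> le_k; rewrite (big_nat_widen 0 k./2 h) //; last by lia.
  by apply: congr_big => // q; lia.
under eq_big_nat => m lt_m do rewrite (widen _ (h - m)%N) ?leq_subr //.
under [RHS]eq_big_nat => d lt_d do rewrite (widen _ d) //.
rewrite (exchange_big_dep_nat xpredT) //=.
rewrite [RHS](exchange_big_dep_nat xpredT) //=.
apply: eq_big_nat => q lt_q.
have -> : \sum_(0 <= m < h.+1 | (2 * q.+1 <= h - m)%N) f m q =
          \sum_(0 <= m < h.+1 - 2 * q.+1) f m q.
  rewrite [RHS](big_nat_widen 0 _ h.+1) ?leq_subr //.
  by rewrite big_nat_cond [RHS]big_nat_cond; apply: congr_big => // m; lia.
have -> : \sum_(0 <= d < h.+1 | (2 * q.+1 <= d)%N) f (d - 2 * q.+1)%N q =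
          \sum_(2 * q.+1 <= d < h.+1) f (d - 2 * q.+1)%N q.
  by rewrite [RHS](big_nat_widenl _ 0) //.
have := big_addn 0 h.+1 (2 * q.+1) xpredT (fun d => f (d - 2 * q.+1)%N q).
rewrite add0n => ->; by apply: eq_big_nat => m _; rewrite addnK.
Qed.

(** Collected by weight, the factor of w_d is the Lucas polynomial of degree d at 2 cos t: the
    isolated weight in [xi] gives its leading term p = 0, the inner sum the terms p = q + 1. *)
Lemma xi_cos (R : realType) (h n : nat) (w : int -> R) i
    (t := i.-1%:R * pi / n%:R) :
  xi h n w i = w 0 + \sum_(0 <= d < h) w d.+1 * (2 * cos (d.+1%:R * t)).
Proof.
rewrite /xi -/t big_add1 /=; set x := 2 * cos t.
pose g (d q : nat) :=
  w d%:Z * ((-1) ^+ q.+1 * (lucas_coef d q.+1)%:R * x ^+ (d - 2 * q.+1)).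
transitivity (\sum_(0 <= m < h.+1) x ^+ m * w m
   + \sum_(0 <= m < h.+1) \sum_(0 <= q < (h - m)./2) g (m + 2 * q.+1)%N q).
  rewrite -big_split /=; apply: eq_big_nat => m _.
  rewrite mulrDr; congr (_ + _); rewrite mulr_sumr; apply: eq_big_nat => q _.
  rewrite /g addnK.
  have -> : (m + 2 * q.+1 = m + 2 * q + 2)%N by lia.
  rewrite -lucas_coef_pochhammer.
  have -> : (m.+1 + 2 * q + 1 = m + 2 * q + 2)%N by lia.
  ring.
rewrite (sum_antidiagonal h (fun m q => g (m + 2 * q.+1)%N q)) -big_split /=.
(* The term d = 0 is set apart: w_0 enters once, whereas 2 cos 0 = 2. *)
rewrite big_nat_recl //= big_geq // expr0 mul1r addr0; congr (_ + _).
apply: eq_big_nat => d _.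
rewrite -lucas_cos -/x big_nat_recl // lucas_coefS0 expr0 !mul1r muln0 subn0.
rewrite mulrDr mulrC; congr (_ + _).
rewrite mulr_sumr [RHS](big_cat_nat _ (n := d.+1./2)) //; last by lia.
rewrite [X in _ = _ + X]big1_seq ?addr0; last first.
  move=> q /andP[_]; rewrite mem_index_iota => q_ge.
  rewrite lucas_coef_eq0; last by lia.
  by rewrite mulr0 mul0r mulr0.
apply: eq_big_nat => q lt_q; rewrite /g.
by have -> : (d.+1 - 2 * q.+1 + 2 * q.+1 = d.+1)%N by lia.
Qed.

(** * Unitary diagonalization, the spectral norm and the Bauer-Fike bound *)

Local Open Scope sesquilinear_scope.

Definition sqnorm (C : numClosedFieldType) n (u : 'rV[C]_n) : C :=
  \sum_j `|u 0 j| ^+ 2.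

Lemma sqnormE (C : numClosedFieldType) n (u : 'rV[C]_n) :
  sqnorm u = (u *m u ^t*) 0 0.
Proof. by rewrite mxE; apply: eq_bigr => j _; rewrite !mxE normCK. Qed.

Lemma sqnorm_unitary (C : numClosedFieldType) n (u : 'rV[C]_n) (P : 'M[C]_n) :
  P \is unitarymx -> sqnorm (u *m P) = sqnorm u.
Proof.
move=> P_unitary; rewrite !sqnormE trmx_mul map_mxM mulmxA.
by rewrite (mulmxtVK _ P_unitary).
Qed.

Lemma sqnorm_ge0 (C : numClosedFieldType) n (u : 'rV[C]_n) : 0 <= sqnorm u.
Proof. by apply: sumr_ge0 => j _; rewrite exprn_ge0. Qed.

Lemma norm_Re (R : rcfType) (z : R[i]) : (complex.Re `|z|)%:C = `|z|.
Proof. by rewrite RRe_real // ger0_real. Qed.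

Lemma conj_map_real_complex (R : rcfType) m n (A : 'M[R]_(m, n)) :
  (map_mx (real_complex R) A) ^t* = (map_mx (real_complex R) A^T).
Proof. by apply/matrixP => i j; rewrite !mxE; exact: conjc_real. Qed.

Lemma mem_spectral_diag (C : numClosedFieldType) n (A : 'M[C]_n) i :
  A \is normalmx -> eigenvalue A (spectral_diag A 0 i).
Proof.
move=> /orthomx_spectralP A_eq; apply/eigenvalueP.
have P_unit := spectral_unit A; exists (row i (spectralmx A)).
  rewrite -row_mul {2}A_eq !mulmxA mulmxV // mul1mx.
  by apply/rowP => j; rewrite mxE mul_diag_mx !mxE.
apply/negP => /eqP row0; move: P_unit; rewrite -row_free_unit => /row_freeP[B].
move/matrixP/(_ i i); rewrite !mxE eqxx => /eqP.
rewrite big1 ?[0 == _]eq_sym ?oner_eq0 //.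
by move=> j _; move/rowP: row0 => /(_ j); rewrite !mxE => ->; rewrite mul0r.
Qed.

Lemma eigenvalue_spectral_diag (C : numClosedFieldType) n (A : 'M[C]_n) l :
  A \is normalmx -> eigenvalue A l -> exists i, l = spectral_diag A 0 i.
Proof.
move=> /orthomx_spectralP A_eq /eigenvalueP[v vA v_neq0].
have P_unit := spectral_unit A; set P := spectralmx A in A_eq P_unit.
pose y := v *m invmx P.
have yD : y *m diag_mx (spectral_diag A) = l *: y.
  by rewrite /y scalemxAl -vA {2}A_eq !mulmxA mulmxK.
have /rV0Pn[i yi] : y != 0.
  by apply: contra v_neq0 => /eqP y0; rewrite -(mulmxKV P_unit v) -/y y0 mul0mx.
clearbody y; exists i; move/rowP/(_ i): yD.
by rewrite mul_mx_diag !mxE mulrC => /(mulIf yi).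
Qed.

Lemma spectral_radius_ub (R : realType) n (A : 'M[R]_n) l :
  map_mx (real_complex R) A \is normalmx -> spectrum A l ->
  `|l| <= (spectral_radius A)%:C.
Proof.
move=> A_normal Al; rewrite -norm_Re lecR.
apply: ub_le_sup; last by exists l.
set D := spectral_diag (map_mx (real_complex R) A).
(* The supremum needs a bounded set; every eigenvalue is one of the diagonal entries, so the sum of
   their moduli is a bound. *)
exists (\sum_i complex.Re `|D 0 i|) => _ [m Am <-].
have [i ->] := eigenvalue_spectral_diag A_normal Am.
rewrite (bigD1 i) // lerDl; apply: sumr_ge0 => j _.
by rewrite -ler0c norm_Re normr_ge0.
Qed.

(** The left side is the Hermitian form of [E^T *m E] at v. In a unitary eigenbasis it is a
    combination of the |y_j|^2 weighted by eigenvalues, which the spectral radius bounds in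
    modulus. *)
Lemma sqnorm_mul_norm2 (R : realType) n (E : 'M[R]_n) (v : 'rV[R[i]]_n) :
  (0 < n)%N ->
  sqnorm (v *m map_mx (real_complex R) E^T)
    <= (norm2 E)%:C ^+ 2 * sqnorm v.
Proof.
move=> n_gt0; set A := map_mx (real_complex R) (E^T *m E).
have A_normal : A \is normalmx.
  by apply/normalmxP; rewrite conj_map_real_complex trmx_mul trmxK.
have P_unitary := spectral_unitarymx A.
have A_eq := orthomx_spectralP A_normal.
rewrite invmx_unitary // in A_eq.
have D_le i : `|spectral_diag A 0 i| <= (spectral_radius (E^T *m E))%:C.
  exact: spectral_radius_ub (mem_spectral_diag _ A_normal).
(* As n > 0 there is an eigenvalue, so the radius is nonnegative and squaring its root gives it
   back. *)
have rho_ge0 : 0 <= spectral_radius (E^T *m E).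
  by rewrite -ler0c; apply: le_trans (D_le (Ordinal n_gt0)).
rewrite /norm2 -rmorphXn /= sqr_sqrtr //.
have : sqnorm (v *m map_mx (real_complex R) E^T) = (v *m A *m v ^t*) 0 0.
  rewrite sqnormE trmx_mul map_mxM conj_map_real_complex trmxK.
  by rewrite /A map_mxM !mulmxA.
set P := spectralmx A in P_unitary A_eq; set D := spectral_diag A in D_le A_eq.
rewrite A_eq => norm_eq; rewrite -[leLHS]ger0_norm ?sqnorm_ge0 // norm_eq.
have PK : P^t* \is unitarymx by rewrite trmxC_unitary.
rewrite -(sqnorm_unitary v PK); set y := v *m P^t*.
have -> : v *m (P^t* *m diag_mx D *m P) *m v ^t* = y *m diag_mx D *m y ^t*.
  by rewrite /y trmx_mul map_mxM trmxCK !mulmxA.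
rewrite mxE /sqnorm mulr_sumr; apply: le_trans (ler_norm_sum _ _ _) _.
apply: ler_sum => j _; rewrite mul_mx_diag !mxE !normrM norm_conjC.
by rewrite mulrAC -expr2 mulrC ler_wpM2r ?exprn_ge0.
Qed.

Lemma char_poly_tr (C : comNzRingType) n (A : 'M[C]_n) :
  char_poly A^T = char_poly A.
Proof.
rewrite /char_poly -[RHS]det_tr; congr (\det _).
by apply/matrixP => i j; rewrite !mxE eq_sym.
Qed.

(** In the orthonormal coordinates y of an eigenvector, E multiplies the j-th one by l - x_j; if all
    these moduli exceeded the norm of E, the image would be too long. *)
Lemma bauer_fike (R : realType) n (H E V : 'M[R]_n) (x : 'rV[R]_n) :
  (0 < n)%N -> V^T *m V = 1%:M -> H *m V = V *m diag_mx x ->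
  forall l, spectrum (H + E) l ->
  exists i, `|l - (x 0 i)%:C| <= (norm2 E)%:C.
Proof.
move=> n_gt0 VTV HV l.
(* [eigenvalue] concerns row vectors; transposing makes the perturbation act as [E^T], which fits
   the product [E^T *m E] in [norm2]. *)
rewrite /spectrum /= eigenvalue_root_char -char_poly_tr -eigenvalue_root_char.
rewrite map_trmx => /eigenvalueP[v vS v_neq0].
set f := map_mx (real_complex R) in vS *.
have fV_unitary : f V \is unitarymx.
  apply/unitarymxP.
  by rewrite conj_map_real_complex -map_mxM (mulmx1C VTV) map_mx1.
(* Being orthogonally diagonalizable over the reals, H is symmetric. *)
have HTV : H^T *m V = V *m diag_mx x.
  have VTH : V^T *m H^T = diag_mx x *m V^T.
    by rewrite -trmx_mul HV trmx_mul tr_diag_mx.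
  rewrite -[H^T]mul1mx -(mulmx1C VTV) -[V *m V^T *m _]mulmxA VTH.
  by rewrite -!mulmxA VTV mulmx1.
pose y := v *m f V.
have yE : v *m f E^T *m f V = \row_j ((l - (x 0 j)%:C) * y 0 j).
  have yH : v *m f H^T *m f V = y *m f (diag_mx x).
    by rewrite /y -!mulmxA -!map_mxM HTV.
  have -> : v *m f E^T = l *: v - v *m f H^T.
    by rewrite -vS /f linearD /= map_mxD mulmxDr addrC addKr.
  rewrite mulmxBl yH -scalemxAl -/y /f map_diag_mx; clearbody y.
  apply/rowP => j.
  by rewrite mul_mx_diag !mxE mulrBl [y 0 j * _]mulrC.
have y_neq0 : y != 0.
  apply: contra v_neq0 => /eqP y0.
  by rewrite -(mulmxtVK v fV_unitary) -/y y0 mul0mx.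
have le_sum : \sum_j `|l - (x 0 j)%:C| ^+ 2 * `|y 0 j| ^+ 2 <=
              \sum_j (norm2 E)%:C ^+ 2 * `|y 0 j| ^+ 2.
  have := sqnorm_mul_norm2 E v n_gt0.
  rewrite -(sqnorm_unitary _ fV_unitary) -(sqnorm_unitary v fV_unitary) yE.
  rewrite -/y /sqnorm mulr_sumr; congr (_ <= _).
  by apply: eq_bigr => j _; rewrite mxE normrM exprMn.
apply/existsP; apply: contraT; rewrite negb_exists => /forallP far.
have norm_ge0 : 0 <= (norm2 E)%:C by rewrite ler0c sqrtr_ge0.
have {}far j : (norm2 E)%:C ^+ 2 < `|l - (x 0 j)%:C| ^+ 2.
  by rewrite ltr_pXn2r ?nnegrE // real_ltNge ?ger0_real.
(* A nonzero coordinate makes the comparison of the two sums strict. *)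
have /rV0Pn[i yi] := y_neq0.
move: le_sum; rewrite real_leNgt; last 2 first.
- by apply/ger0_real/sumr_ge0 => j _; rewrite mulr_ge0 ?exprn_ge0.
- by apply/ger0_real/sumr_ge0 => j _; rewrite mulr_ge0 ?exprn_ge0.
rewrite (bigD1 i) // [X in _ < X](bigD1 i) //= => /negP[]; apply: ltr_leD.
  by rewrite ltr_pM2r ?far // exprn_gt0 ?normr_gt0.
by apply: ler_sum => j _; rewrite ler_wpM2r ?exprn_ge0 // ltW.
Qed.

(** * The orthonormal eigenbasis of [T11] *)

(* i.-1 = i at i = 0 and minn i.+1 n.-1 = i at i = n - 1: the truncations account
   for the two corner entries of T11. *)
Lemma sum_T11 (R : realType) n (g : nat -> R) (i : 'I_n) : (1 < n)%N ->
  \sum_k T11 R n i k * g k = g i.-1 + g (minn i.+1 n.-1).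
Proof.
move=> n_gt1.
have delta m : (m < n)%N -> \sum_(k < n) (k == m :> nat)%:R * g k = g m.
  move=> lt_m; rewrite (bigD1 (Ordinal lt_m)) //= eqxx mul1r big1 ?addr0 //.
  by move=> k /negPf; rewrite -val_eqE /= => ->; rewrite mul0r.
have lt_i := ltn_ord i.
rewrite -!delta; try lia; rewrite -big_split /=; apply: eq_bigr => k _.
rewrite -mulrDl mxE -natrD; set c := [|| _, _ | _]; congr (_ * _).
have -> : ((k == i.-1 :> nat) + (k == minn i.+1 n.-1 :> nat))%N = c.
  have := ltn_ord k; rewrite /c (_ : (i == k) = (i == k :> nat)) //; lia.
by case: c.
Qed.

Section EigenbasisT11.
Context (R : realType) (n : nat) (n_gt1 : (1 < n)%N).

Definition t11_angle (k : nat) : R := k%:R * pi / n%:R.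

(** The unnormalized vectors of the discrete cosine transform DCT-II. *)
Definition t11_vec (k j : nat) : R := cos ((j%:R + 2^-1) * t11_angle k).

Lemma sin_nat_pi k : sin (k%:R * pi) = 0 :> R.
Proof.
elim: k => [|k IH]; first by rewrite mul0r sin0.
by rewrite -natr1 mulrDl mul1r sinDpi IH oppr0.
Qed.

(** Inside, this is cos(a - t) + cos(a + t) = 2 cos t cos a. The half shift makes the vector even
    about both ends, which accounts for the corner entries. *)
Lemma t11_vecP k (i : 'I_n) :
  \sum_j T11 R n i j * t11_vec k j = 2 * cos (t11_angle k) * t11_vec k i.
Proof.
rewrite (sum_T11 (t11_vec k)) // /t11_vec; set t := t11_angle k.
set a := (i%:R + 2^-1) * t.
have -> : cos ((i.-1%:R + 2^-1) * t) = cos (a - t).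
  rewrite /a; case: (val i) => [|m] /=; last by congr cos; rewrite -natr1; ring.
  by rewrite -[RHS]cosN; congr cos; lra.
have -> : cos (((minn i.+1 n.-1)%:R + 2^-1) * t) = cos (a + t).
  have [lt_i|ge_i] := ltnP i.+1 n.
    have -> : minn i.+1 n.-1 = i.+1 by lia.
    by congr cos; rewrite /a -natr1; ring.
  have n_neq0 : n%:R != 0 :> R by rewrite pnatr_eq0; lia.
  have nt : n%:R * t = k%:R * pi by rewrite /t /t11_angle; field.
  have i_n : i%:R + 1 = n%:R :> R.
    by rewrite natr1; congr _%:R; have := ltn_ord i; lia.
  have -> : minn i.+1 n.-1 = i by have := ltn_ord i; lia.
  (* The last node and the one beyond it are symmetric about n t = k pi, where the sine vanishes. *)
  have -> : (i%:R + 2^-1) * t = k%:R * pi - t / 2 by rewrite -nt -i_n; field.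
  have -> : a + t = k%:R * pi + t / 2 by rewrite /a -nt -i_n; field.
  by rewrite cosB cosD sin_nat_pi !mul0r addr0 subr0.
by rewrite cosB cosD; ring.
Qed.

Lemma t11_angle_ge0 k : 0 <= t11_angle k.
Proof. by rewrite /t11_angle !mulr_ge0 ?invr_ge0 ?pi_ge0. Qed.

Lemma t11_angle_lt_pi k : (k < n)%N -> t11_angle k < pi.
Proof.
move=> lt_k; rewrite /t11_angle ltr_pdivrMr ?ltr0n; last by lia.
by rewrite mulrC ltr_pM2l ?pi_gt0 // ltr_nat.
Qed.

Lemma t11_vec0_neq0 k : (k < n)%N -> t11_vec k 0 != 0.
Proof.
move=> /t11_angle_lt_pi lt_pi; have ge0 := t11_angle_ge0 k.
have pi0 := @pi_gt0 R.
by rewrite gt_eqF // cos_gt0_pihalf //; lra.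
Qed.

Lemma t11_eigenvalue_inj (k l : 'I_n) :
  cos (t11_angle k) = cos (t11_angle l) -> k = l.
Proof.
move=> /cos_inj; rewrite !in_itv /= !t11_angle_ge0 !ltW ?t11_angle_lt_pi //.
move=> /(_ isT isT) /eqP; rewrite /t11_angle.
have n_neq0 : n%:R != 0 :> R by rewrite pnatr_eq0; lia.
have pi_neq0 : pi != 0 :> R by rewrite gt_eqF // pi_gt0.
rewrite (inj_eq (mulIf _)) ?invr_eq0 // (inj_eq (mulIf pi_neq0)) eqr_nat.
by move=> /eqP /val_inj.
Qed.

Definition t11_sqnorm (k : nat) : R := \sum_(j < n) t11_vec k j ^+ 2.

(** Dividing by the norm as a sum spares its evaluation. *)
Definition t11_basis : 'M[R]_n :=
  \matrix_(j, k) (t11_vec k j / Num.sqrt (t11_sqnorm k)).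

Lemma t11_sqnorm_gt0 k : (k < n)%N -> 0 < t11_sqnorm k.
Proof.
move=> lt_k; have n_gt0 : (0 < n)%N by lia.
rewrite /t11_sqnorm (bigD1 (Ordinal n_gt0)) //= ltr_pwDl //.
  by rewrite exprn_even_gt0 //= t11_vec0_neq0.
by apply: sumr_ge0 => j _; rewrite sqr_ge0.
Qed.

Lemma T11_basis : T11 R n *m t11_basis =
  t11_basis *m diag_mx (\row_k (2 * cos (t11_angle k))).
Proof.
apply/matrixP => i k; rewrite mul_mx_diag !mxE.
under eq_bigr => j _ do rewrite [t11_basis j k]mxE mulrA.
by rewrite -mulr_suml t11_vecP; ring.
Qed.

Lemma trmx_T11 : (T11 R n)^T = T11 R n.
Proof.
apply/matrixP => i j; rewrite !mxE [j == i]eq_sym.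
have -> : (i == j) = (i == j :> nat) by [].
by congr (if _ then _ else _); lia.
Qed.

(** By symmetry of [T11], the Gram matrix commutes with a diagonal matrix with distinct entries,
    hence is diagonal; no cosine sum is computed. *)
Lemma t11_basis_orthogonal : t11_basis^T *m t11_basis = 1%:M.
Proof.
pose M := diag_mx (\row_(k < n) (2 * cos (t11_angle k))).
have comm : (t11_basis^T *m t11_basis) *m M = M *m (t11_basis^T *m t11_basis).
  rewrite -mulmxA -T11_basis mulmxA -[in LHS]trmx_T11 -trmx_mul T11_basis.
  by rewrite trmx_mul tr_diag_mx mulmxA.
apply/matrixP => k l; rewrite [RHS]mxE.
have [<-|neq_kl] := eqVneq k l.
  have N_gt0 := t11_sqnorm_gt0 (ltn_ord k).
  rewrite mxE; under eq_bigr => j _ do rewrite !mxE.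
  transitivity (t11_sqnorm k / Num.sqrt (t11_sqnorm k) ^+ 2).
    rewrite /t11_sqnorm mulr_suml; apply: eq_bigr => j _.
    by rewrite !expr2 invfM; ring.
  by rewrite sqr_sqrtr ?ltW // divff // gt_eqF.
move/matrixP/(_ k l): comm; rewrite mul_mx_diag mul_diag_mx !mxE.
set s := \sum_j _; rewrite mulrC => /eqP; rewrite -subr_eq0 -mulrBl mulf_eq0.
rewrite -mulrBr mulf_eq0 pnatr_eq0 /= subr_eq0 => /orP[/eqP eq_cos|/eqP //].
by rewrite (t11_eigenvalue_inj (esym eq_cos)) eqxx in neq_kl.
Qed.

(** In the eigenbasis H commutes with a diagonal matrix with distinct entries, so it is diagonal
    too; row 0 then determines each entry, as [t11_vec k 0] is nonzero. *)
Lemma tau11_diag (H : 'M[R]_n) (x : 'rV[R]_n) (i0 : 'I_n) :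
  tau11 H -> i0 = 0%N :> nat ->
  (forall k : 'I_n, \sum_j H i0 j * t11_vec k j = x 0 k * t11_vec k 0) ->
  H *m t11_basis = t11_basis *m diag_mx x.
Proof.
rewrite /tau11 /= => HT i0_eq0 row0.
have VTV := t11_basis_orthogonal; have VVT := mulmx1C VTV.
set V := t11_basis in VTV VVT *.
pose M := diag_mx (\row_(k < n) (2 * cos (t11_angle k))).
pose G := V^T *m H *m V.
have HV : H *m V = V *m G by rewrite /G !mulmxA VVT mul1mx.
have TV : T11 R n *m V = V *m M := T11_basis.
have comm : M *m G = G *m M.
  have VTT : V^T *m T11 R n = M *m V^T.
    by rewrite -[in LHS]trmx_T11 -trmx_mul TV trmx_mul tr_diag_mx.
  rewrite /G !mulmxA -VTT -[X in X *m V]mulmxA HT.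
  by rewrite -!mulmxA TV.
have G_diag k l : k != l -> G k l = 0.
  move=> neq_kl; move/matrixP/(_ k l): comm.
  rewrite mul_mx_diag mul_diag_mx; clearbody G; rewrite !mxE mulrC => /eqP.
  rewrite -subr_eq0 -mulrBr mulf_eq0 => /orP[/eqP //|].
  rewrite -mulrBr mulf_eq0 pnatr_eq0 /= subr_eq0 => /eqP eq_cos.
  by rewrite (t11_eigenvalue_inj eq_cos) eqxx in neq_kl.
rewrite HV; congr (_ *m _); apply/matrixP => k l; rewrite [RHS]mxE.
have [<-|neq_kl] := eqVneq k l; last by rewrite G_diag.
move/matrixP/(_ i0 k): HV; rewrite [RHS]mxE (bigD1 k) //=.
rewrite big1 ?addr0; last first.
  by move=> l' neq; rewrite G_diag ?mulr0.
rewrite mxE; under eq_bigr => j _ do rewrite [V j k]mxE mulrA.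
rewrite -mulr_suml row0 [V i0 k]mxE i0_eq0 -mulrA mulrC => /mulfI -> //.
rewrite mulf_neq0 ?t11_vec0_neq0 // invr_eq0 sqrtr_eq0 -ltNge.
exact: t11_sqnorm_gt0.
Qed.

End EigenbasisT11.

(** * Eigenvalues of H from its first row, and the conclusion *)

(** For d >= 1, w_d stands in columns d - 1 and d, and cos((d-1/2)t) + cos((d+1/2)t) = 2 cos(dt)
    cos(t/2); w_0 stands in column 0 only. *)
Lemma first_row_eigenvalue (R : realType) h n (w : int -> R) k :
  (h < n)%N ->
  \sum_(j < n) (if (j < h)%N then w j%:Z + w j.+1%:Z
                else if j == h :> nat then w h%:Z else 0) * t11_vec R n k j =
  xi h n w k.+1 * t11_vec R n k 0.
Proof.
move=> lt_hn; rewrite xi_cos -/(t11_angle R n k) /=.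
set t := t11_angle R n k; set g := t11_vec R n k.
rewrite -(big_mkord xpredT (fun j => (if (j < h)%N then w j%:Z + w j.+1%:Z
  else if j == h :> nat then w h%:Z else 0) * g j)).
rewrite (big_cat_nat _ (n := h.+1)) //=.
rewrite [X in _ + X = _]big1_seq ?addr0; last first.
  move=> j /andP[_]; rewrite mem_index_iota => /andP[lt_hj _].
  by rewrite ifF; [rewrite ifF ?mul0r //; lia | lia].
rewrite big_nat_recr //= ltnn eqxx.
have -> : \sum_(0 <= j < h) (if (j < h)%N then w j%:Z + w j.+1%:Z
            else if j == h :> nat then w h%:Z else 0) * g j =
          \sum_(0 <= j < h) w j%:Z * g j + \sum_(0 <= j < h) w j.+1%:Z * g j.
  rewrite -big_split /=; apply: eq_big_nat => j /andP[_ ->].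
  by rewrite mulrDl.
rewrite addrAC -(big_nat_recr h 0 (fun j => w j%:Z * g j)) // big_nat_recl //.
rewrite -addrA -big_split /= mulrDl mulr_suml; congr (_ + _).
apply: eq_bigr => j _; rewrite -mulrDr -mulrA; congr (_ * _).
rewrite /g /t11_vec -/t.
have -> : (j.+1%:R + 2^-1) * t = j.+1%:R * t + t / 2 by ring.
have -> : (j%:R + 2^-1) * t = j.+1%:R * t - t / 2 by rewrite -natr1; field.
have -> : (0 + 2^-1) * t = t / 2 by ring.
by rewrite cosB cosD; ring.
Qed.

Theorem theorem2 (R : realType) (h n : nat) (w : int -> R) (S H : 'M[R]_n)
    (h_ge1 : (1 <= h)%N) (n_gt2h : (2 * h < n)%N)
    (w_sym : symmetric_filter h w)
    (S_smooth : smoothing_matrix h w S)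
    (H_tau11 : tau11_of_filter h w H) :
  forall lambda : R[i], spectrum S lambda ->
  exists i : nat, (1 <= i <= n)%N /\
    `|lambda - (xi h n w i)%:C| <= (norm2 (S - H))%:C.
Proof.
move=> lambda S_lambda.
have n_gt0 : (0 < n)%N by lia.
have n_gt1 : (1 < n)%N by lia.
have lt_hn : (h < n)%N by lia.
have [H_comm H_row] := H_tau11.
have HV : H *m t11_basis R n =
          t11_basis R n *m diag_mx (\row_k xi h n w k.+1).
  apply: (tau11_diag n_gt1 (i0 := Ordinal n_gt0)) => // k.
  rewrite mxE -first_row_eigenvalue //.
  by apply: eq_bigr => j _; rewrite H_row.
have H_lambda : spectrum (H + (S - H)) lambda by rewrite subrKC.
have [k le_k] := bauer_fike n_gt0 (t11_basis_orthogonal _ n_gt1) HV H_lambda.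
(* Columns count from 0, while [xi] counts from 1 and uses the angle (i-1) pi / n. *)
exists k.+1; split; first exact: ltn_ord.
by move: le_k; rewrite mxE.
Qed.
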